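(* Let $k>2$ and $r\ge1$ be integers and let $D_{2^k(2r+1)}=\langle x,y\mid x^{2^k}=1,\ y^{2r+1}=1,\ xyx^{-1}=y^{-1}\rangle$. The $2^{k-1}(r+2)$ irreducible complex characters of $D_{2^k(2r+1)}$ are, without repetition, the characters $\chi_j$ of $\alpha_j$ for $0\le j\le2^k-1$ and the characters $\chi_{t,s}$ of $\varrho_{t,s}$ for $1\le t\le2r$, $0\le s\le2^{k-2}-1$. Their values on the conjugacy classes $\mathsf{1}_l$, $\mathsf{2}_{l,q}$, $(\mathsf{2r+1})_l$ ($0\le l\le2^{k-1}-1$, $1\le q\le r$) are: - $\chi_j$: $\ \zeta_{2^k}^{2lj}$ on $\mathsf{1}_l$, $\ \zeta_{2^k}^{2lj}$ on $\mathsf{2}_{l,q}$, $\ \zeta_{2^k}^{(2l+1)j}$ on $(\mathsf{2r+1})_l$; - $\chi_{t,s}$: $\ (-1)^{tl}\,2\,\zeta_{2^k}^{2ls}$ on $\mathsf{1}_l$, $\ (-1)^{tl}\zeta_{2^k}^{2ls}\bigl(\zeta_{2r+1}^{tq}+\zeta_{2r+1}^{-tq}\bigr)$ on $\mathsf{2}_{l,q}$, $\ 0$ on $(\mathsf{2r+1})_l$.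
   Context: Put $\zeta_n=e^{2\pi i/n}$. The one-dimensional representations are $\alpha_j(x)=\zeta_{2^k}^j$, $\alpha_j(y)=1$. For integers $t,s$ the two-dimensional representation $\varrho_{t,s}$ is $$\varrho_{t,s}(x)=\zeta_{2^k}^s\begin{pmatrix}0&1\\(-1)^t&0\end{pmatrix},\qquad \varrho_{t,s}(y)=\begin{pmatrix}\zeta_{2r+1}^t&0\\0&\zeta_{2r+1}^{-t}\end{pmatrix}.$$ The conjugacy classes of the group are, for $0\le l\le2^{k-1}-1$ and $1\le q\le r$: $\mathsf{1}_l=\{x^{2l}\}$, $\mathsf{2}_{l,q}=\{x^{2l}y^q,x^{2l}y^{-q}\}$, $(\mathsf{2r+1})_l=\{x^{2l+1}y^a\mid 0\le a\le2r\}$. *)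

(* Defs.v *)
From HB Require Import structures.
From mathcomp Require Import all_boot all_order all_fingroup all_algebra.
From mathcomp Require Import all_solvable all_field all_character.

Set Implicit Arguments.
Unset Strict Implicit.
Unset Printing Implicit Defensive.

Import GroupScope Order.TTheory GRing.Theory Num.Theory.
Local Open Scope ring_scope.

(* G is the group <a, b | a ^ 2^k = 1, b ^ (2r+1) = 1, a b a^-1 = b^-1>, with
   x and y as the generators a and b. Since \isog Grp only mentions the
   isomorphism type, the relations are repeated for x and y themselves; as the
   presented group is finite, generators x, y of G that satisfy the relations
   are the images of a, b under an isomorphism. *)
Definition D_presentation (k r : nat) (gT : finGroupType) (G : {group gT})
    (x y : gT) : Prop :=
  [/\ G \isog Grp (a : b :
        a ^+ (2 ^ k)%N, b ^+ (2 * r + 1)%N, a * b * a^-1 = b^-1),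
      G :=: <<[set x; y]>>,
      (x ^+ (2 ^ k) = 1)%g,
      (y ^+ (2 * r + 1) = 1)%g
    & (x * y * x^-1 = y^-1)%g].

(* e^(2 i pi / n) for n > 0: n.-root (-1) is the n-th root of -1 of least
   nonnegative argument, that is e^(i pi / n). *)
Definition zeta (n : nat) : algC := (n.-root (-1)) ^+ 2.

Definition mx2 (a b c d : algC) : 'M[algC]_2 :=
  \matrix_(i < 2, j < 2)
    if i == 0 then (if j == 0 then a else b) else (if j == 0 then c else d).

Definition alpha_x (k j : nat) : 'M[algC]_1 := (zeta (2 ^ k) ^+ j)%:M.

Definition rho_x (k t s : nat) : 'M[algC]_2 :=
  zeta (2 ^ k) ^+ s *: mx2 0 1 ((-1) ^+ t) 0.

Definition rho_y (r t : nat) : 'M[algC]_2 :=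
  mx2 (zeta (2 * r + 1) ^+ t) 0 0 (zeta (2 * r + 1) ^- t).

Section Classes.

Variables (gT : finGroupType) (x y : gT).
Local Open Scope group_scope.

Definition class_1 (l : nat) : {set gT} := [set x ^+ (2 * l)%N].

Definition class_2 (l q : nat) : {set gT} :=
  [set x ^+ (2 * l)%N * y ^+ q; x ^+ (2 * l)%N * y ^- q].

Definition class_odd (r l : nat) : {set gT} :=
  [set x ^+ (2 * l + 1)%N * y ^+ a | a : 'I_(2 * r + 1)%N].

End Classes.

(* Main.v *)
(** The presented group is a semidirect product of its subgroups of orders
    [2r+1] and [2^k], so every element is uniquely [x^i y^a] and pairs of
    matrices satisfying the relations extend to representations. Conjugation
    shows that every class is one of the [N = 2^(k-1) (r+2)] sets of the list.
    The representations [rho_(t,s)] do not kill the commutator [y^-2], so their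
    degree 2 characters are irreducible; degrees and values at [x], [x^2], [y]
    separate the [N] listed characters. As there are as many irreducible characters as
    classes, both lists are complete and free of repetitions.

    That [zeta n] is a primitive [n]-th root of unity has to be extracted from
    the maximality of the real part of [n.-root (-1)]. *)

Require Import Defs.
From HB Require Import structures.
From mathcomp Require Import all_boot all_order all_fingroup all_algebra.
From mathcomp Require Import all_solvable all_field all_character.
From mathcomp Require Import ring lra zify.

Set Implicit Arguments.
Unset Strict Implicit.
Unset Printing Implicit Defensive.

Import GroupScope Order.TTheory GRing.Theory Num.Theory.
Local Open Scope ring_scope.

(** * Primitivity of [zeta n] *)

(* With [v = a + ib] and [u = c + id], [max_a] reads [Re (v / u) <= Re v], and the
   last two conclusions concern [Im (u / v)] and [Re (u / v)]. *)
Lemma unit_circle_sector (R : realFieldType) (a b c d : R) :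
    a ^+ 2 + b ^+ 2 = 1 -> c ^+ 2 + d ^+ 2 = 1 -> 0 <= b -> 0 < d ->
    a * c + b * d <= a ->
  [/\ 0 <= a, c < a, 0 <= d * a - c * b & b != 0 -> c < c * a + d * b].
Proof.
move=> v_unit u_unit b_ge0 d_gt0 max_a.
have d2_gt0 : 0 < d ^+ 2 by rewrite exprn_gt0.
have c_lt1 : c < 1.
  by rewrite ltNge; apply/negP=> c_ge1; have := exprn_ege1 2 c_ge1; lra.
have a_ge0 : 0 <= a.
  have h : 0 <= a * (1 - c) by have := mulr_ge0 b_ge0 (ltW d_gt0); lra.
  by rewrite pmulr_lge0 ?subr_gt0 in h.
have lt_ca : c < a.
  rewrite ltNge; apply/negP=> le_ac.
  have le_db : d <= b.
    rewrite -(@ler_pXn2r _ 2) ?nnegrE ?(ltW d_gt0) //.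
    have : a ^+ 2 <= c ^+ 2 by rewrite ler_pXn2r ?nnegrE // (le_trans a_ge0).
    lra.
  have h1 : d ^+ 2 <= b * d by rewrite expr2 ler_pM2r.
  (* Here [d^2 = (1 - c)(1 + c)] and [max_a] gives [b d <= a (1 - c)]. Cancelling [1 - c] leaves
     [1 + c <= a], against [a <= c < 1]. *)
  have : (1 - c) * (1 + c) <= (1 - c) * a by lra.
  by rewrite ler_pM2l ?subr_gt0 //; lra.
split=> //.
  have da0 : 0 <= d * a by rewrite mulr_ge0 // ltW.
  have [c_le0 | c_gt0] := lerP c 0.
    by have := mulr_le0_ge0 c_le0 b_ge0; lra.
  rewrite subr_ge0 -(@ler_pXn2r _ 2) ?nnegrE // ?mulr_ge0 ?(ltW c_gt0) //.
  have h : c ^+ 2 <= a ^+ 2 by rewrite ler_pXn2r ?nnegrE // ltW.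
  rewrite !exprMn.
  have -> : b ^+ 2 = 1 - a ^+ 2 by lra.
  have -> : d ^+ 2 = 1 - c ^+ 2 by lra.
  lra.
move=> b_neq0; have b_gt0 : 0 < b by rewrite lt0r b_neq0.
have b2_gt0 : 0 < b ^+ 2 by rewrite exprn_gt0.
have a_lt1 : a < 1.
  by rewrite ltNge; apply/negP=> a_ge1; have := exprn_ege1 2 a_ge1; lra.
have db0 : 0 < d * b by rewrite mulr_gt0.
have [c_le0 | c_gt0] := lerP c 0.
  have : 0 <= - c * (1 - a) by rewrite mulr_ge0 //; lra.
  lra.
(* Both sides are nonnegative; after squaring and cancelling [1 - a] the claim becomes
   [2 c^2 < 1 + a], which follows from [c^2 < c < a < 1]. *)
suff : c * (1 - a) < d * b by lra.
have h0 : 0 <= c * (1 - a) by rewrite mulr_ge0 //; lra.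
rewrite -(@ltr_pXn2r _ 2) ?nnegrE ?(ltW db0) //.
rewrite !exprMn.
have -> : b ^+ 2 = (1 - a) * (1 + a) by lra.
have -> : d ^+ 2 = 1 - c ^+ 2 by lra.
have -> : (1 - a) ^+ 2 = (1 - a) * (1 - a) by [].
rewrite mulrCA [X in _ < X]mulrCA ltr_pM2l ?subr_gt0 //.
have h : c ^+ 2 < c by rewrite expr2 -[X in _ < X]mulr1 ltr_pM2l.
lra.
Qed.

Lemma Re_Im_unit n (v : algC) :
  (0 < n)%N -> `|v ^+ n| = 1 -> 'Re v ^+ 2 + 'Im v ^+ 2 = 1.
Proof.
move=> n_gt0 vn; rewrite -normC2_Re_Im.
suff /eqP-> : `|v| == 1 by rewrite expr1n.
by rewrite -(pexpr_eq1 n_gt0) // -normrX vn.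
Qed.

Lemma Re_ge0_unity_eq1 n (v : algC) :
  (0 < n)%N -> v ^+ n = 1 -> 0 <= 'Re v -> 'Im v = 0 -> v = 1.
Proof.
move=> n_gt0 vn ge0 im0.
have v_ge0 : 0 <= v by rewrite [v]Crect im0 mulr0 addr0.
by apply/eqP; rewrite -(pexpr_eq1 n_gt0 v_ge0) vn.
Qed.

(** A real [u] would have to be [-1], the point of the unit circle with least real part. Maximality
    of ['Re u] then makes [-1] the only [n]-th root of [-1], first in the upper half plane and then
    everywhere by conjugation; but [u * w], with [w] a primitive [n]-th root of unity, is another
    one. *)
Lemma Im_rootCN1_gt0 n : (1 < n)%N -> 0 < 'Im (n.-root (-1) : algC).
Proof.
move=> n_gt1; have n_gt0 := ltnW n_gt1.
set u : algC := n.-root _.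
have un : u ^+ n = -1 by rewrite rootCK.
rewrite lt0r Im_rootC_ge0 // andbT; apply/eqP=> im0.
have unit_of (z : algC) : z ^+ n = -1 -> 'Re z ^+ 2 + 'Im z ^+ 2 = 1.
  by move=> zn; apply: (Re_Im_unit n_gt0); rewrite zn normrN1.
have : 'Re u ^+ 2 == 1 by rewrite -(unit_of u un) im0 expr0n addr0.
rewrite sqrf_eq1 => /orP[/eqP re1|/eqP re1].
  have : u ^+ n == 1 by rewrite [u]Crect im0 re1 mulr0 addr0 expr1n.
  by rewrite un eqNr oner_eq0.
have uN1 : u = -1 by rewrite [u]Crect im0 re1 mulr0 addr0.
have [w wP] := C_prim_root_exists n_gt0.
suff max (z : algC) : z ^+ n = -1 -> 0 <= 'Im z -> z = -1.
  have /eqP : u * w = -1.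
    have zn : (u * w) ^+ n = -1 by rewrite exprMn un (prim_expr_order wP) mulr1.
    have : 'Im (u * w) \is Num.real by exact: Creal_Im.
    case/real_ge0P=> [/(max _ zn) //|lt0].
    apply: (can_inj (@conjCK algC)); rewrite rmorphN1.
    apply: max; first by rewrite -rmorphXn zn rmorphN1.
    by rewrite Im_conj oppr_ge0 ltW.
  rewrite uN1 mulN1r eqr_opp -[w]expr1 -(prim_order_dvd wP) dvdn1.
  by rewrite gtn_eqF.
move=> zn im_ge0.
have := rootC_Re_max n_gt0 zn im_ge0; rewrite -/u re1 => le_re.
have h : 1 <= 'Re z ^+ 2.
  rewrite -sqrrN -[X in X <= _](expr1n _ 2) lerXn2r ?nnegrE //.
    by rewrite (le_trans ler01) // lerNr.
  by rewrite lerNr.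
have im2 : 'Im z ^+ 2 <= 0.
  by rewrite -(lerD2l ('Re z ^+ 2)) addr0 (unit_of z zn).
have imz : 'Im z = 0.
  by apply/eqP; rewrite -sqrf_eq0 eq_le im2 real_exprn_even_ge0 ?Creal_Im.
have : 'Re z ^+ 2 == 1 by rewrite -(unit_of z zn) imz expr0n addr0.
rewrite sqrf_eq1 => /orP[/eqP rz1|/eqP rz1].
  by rewrite rz1 in le_re; have := le_trans ler01 le_re; rewrite oppr_ge0 ler10.
by rewrite [z]Crect imz rz1 mulr0 addr0.
Qed.

(* A [2n]-th root of unity [v] that no rotation by [u] or [u^-1] brings closer
   to [1] lies strictly closer to [1] than [u]; were it not [1], then either
   [v] or [u / v] (up to conjugation) would be a root of [-1] closer to [1]
   than [u]. *)
Lemma rootCN1_max_eq1 n (v : algC) (u := n.-root (-1)) :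
    (1 < n)%N -> v ^+ (2 * n) = 1 ->
    'Re (u * v) <= 'Re v -> 'Re (u^-1 * v) <= 'Re v ->
  v = 1.
Proof.
move=> n_gt1 v2n; have n_gt0 := ltnW n_gt1.
have n2_gt0 : (0 < 2 * n)%N by rewrite muln_gt0.
have un : u ^+ n = -1 by rewrite rootCK.
have u1 : `|u ^+ n| = 1 by rewrite un normrN1.
have u1' := Re_Im_unit n_gt0 u1.
have -> : u^-1 = u^*.
  by rewrite invC_norm normC2_Re_Im u1' invr1 mul1r.
have v1 : `|v ^+ (2 * n)| = 1 by rewrite v2n normr1.
have v1' := Re_Im_unit n2_gt0 v1.
(* Conjugating [v] exchanges the two maximality hypotheses, as [u^-1] is the conjugate of [u]. *)
wlog b_ge0 : v v2n v1 v1' / 0 <= 'Im v.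
  move=> IH; have : 'Im v \is Num.real by exact: Creal_Im.
  case/real_ge0P=> [/(IH _ v2n)|lt0]; first exact.
  move=> h1 h2; apply: (can_inj (@conjCK algC)); rewrite rmorph1.
  apply: IH; rewrite -?rmorphXn ?v2n ?rmorph1 ?normr1 //.
  - by rewrite Re_conj Im_conj sqrrN.
  - by rewrite Im_conj oppr_ge0 ltW.
  - by rewrite -['Re (v^*)]Re_conj -Re_conj rmorphM /= !conjCK.
  - by rewrite -['Re (v^*)]Re_conj -Re_conj rmorphM /= !conjCK.
move=> _ max_v; apply/eqP; apply/negPn/negP=> v_neq1.
have d_gt0 := Im_rootCN1_gt0 n_gt1; rewrite -/u in d_gt0.
(* Real and imaginary parts are moved to [algR], a totally ordered field to which
   [unit_circle_sector] applies. *)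
pose a := in_algR (Creal_Re v); pose b := in_algR (Creal_Im v).
pose c := in_algR (Creal_Re u); pose d := in_algR (Creal_Im u).
have mulE (z1 z2 : algC) : 'Re (z1 * z2) = 'Re z1 * 'Re z2 - 'Im z1 * 'Im z2.
  by rewrite {1}[z1]Crect {1}[z2]Crect mulC_rect Re_rect // ?rpredB ?rpredD ?rpredM.
have mulI (z1 z2 : algC) : 'Im (z1 * z2) = 'Re z1 * 'Im z2 + 'Re z2 * 'Im z1.
  by rewrite {1}[z1]Crect {1}[z2]Crect mulC_rect Im_rect // ?rpredB ?rpredD ?rpredM.
have h1 : a ^+ 2 + b ^+ 2 = 1 by apply: val_inj.
have h2 : c ^+ 2 + d ^+ 2 = 1 by apply: val_inj.
have h3 : 0 <= b by [].
have h4 : 0 < d by [].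
have h5 : a * c + b * d <= a.
  by move: max_v; rewrite mulE Re_conj Im_conj mulNr opprK mulrC (mulrC ('Im u)).
have [a_ge0 lt_ca im_ge0 lt_re] := unit_circle_sector h1 h2 h3 h4 h5.
have b_neq0 : b != 0.
  apply: contraNneq v_neq1 => b0.
  by rewrite (Re_ge0_unity_eq1 n2_gt0 v2n) //; apply: (congr1 val b0).
have : (v ^+ n) ^+ 2 == 1 by rewrite -exprM mulnC v2n.
rewrite sqrf_eq1 => /orP[]/eqP vn; last first.
  have /lt_geF : 'Re u < 'Re v by exact: lt_ca.
  by rewrite (rootC_Re_max n_gt0 vn b_ge0).
have zn : (u * v^*) ^+ n = -1 by rewrite exprMn un -rmorphXn vn rmorph1 mulr1.
have := rootC_Re_max n_gt0 zn; rewrite -/u mulE mulI Re_conj Im_conj !mulrN opprK.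
move=> le_re; have : 'Re u < 'Re u * 'Re v + 'Im u * 'Im v by exact: lt_re.
rewrite le_gtF // le_re // addrC mulrC; exact: im_ge0.
Qed.

(** Let [u] be the chosen root of [-1] and [w] any primitive [2n]-th root of unity. Among the
    products [u ^+ i * w], one of maximal real part equals [1] by [rootCN1_max_eq1]. So [w] is the
    inverse of a power of [u], which forces [u] to have order [2n] and its square [zeta n] to have
    order [n]. *)
Lemma zeta_prim n : (0 < n)%N -> n.-primitive_root (zeta n).
Proof.
rewrite leq_eqVlt => /predU1P[<-|n_gt1].
  rewrite /zeta root1C sqrrN expr1n; apply/andP; split=> //.
  by apply/forallP=> i; rewrite !ord1 unity_rootE expr1n eqxx.
have n_gt0 := ltnW n_gt1; have n2_gt0 : (0 < 2 * n)%N by rewrite muln_gt0.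
rewrite /zeta; set u := n.-root _.
have un : u ^+ n = -1 by rewrite rootCK.
have u2n : u ^+ (2 * n) = 1 by rewrite mulnC exprM un sqrrN expr1n.
suff uP : (2 * n).-primitive_root u.
  by have := dvdn_prim_root uP (dvdn_mull 2 (dvdnn n)); rewrite mulnK.
have [w wP] := C_prim_root_exists n2_gt0.
pose f (i : 'I_(2 * n)) : algR := in_algR (Creal_Re (u ^+ i * w)).
pose j := [arg max_(i > Ordinal n2_gt0) f i]%O.
have max_j m : 'Re (u ^+ m * w) <= 'Re (u ^+ j * w).
  have := ltn_pmod m n2_gt0 => lt_m.
  rewrite -(expr_mod m u2n) /j; case: arg_maxP => //= i _ /(_ (Ordinal lt_m) isT).
  by [].
have w1 : u ^+ j * w = 1.
  apply: (@rootCN1_max_eq1 n); rewrite // -/u.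
  - by rewrite exprMn exprAC u2n expr1n mul1r (prim_expr_order wP).
  - by rewrite mulrA -exprS max_j.
  - have u_neq0 : u != 0 by rewrite rootC_eq0 ?oppr_eq0 ?oner_eq0.
    (* Rotation by [u^-1] is rotation by [u ^+ (2n - 1)], hence covered by [max_j]. *)
    suff -> : u^-1 * (u ^+ j * w) = u ^+ (2 * n).-1 * (u ^+ j * w).
      by rewrite mulrA -exprD max_j.
    by congr (_ * _); apply: (mulfI u_neq0); rewrite divff // -exprS prednK.
have [m mP] := prim_order_exists n2_gt0 u2n.
move=> m_dvd; suff n_dvd : (2 * n %| m)%N.
  by have /eqP -> : (2 * n == m)%N by rewrite eqn_dvd n_dvd.
rewrite (prim_order_dvd wP); apply/eqP.
have := congr1 (fun z => z ^+ m) w1.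
by rewrite /= exprMn exprAC (prim_expr_order mP) !expr1n mul1r.
Qed.

(** * Lower bound for the order of the presented group *)

Lemma Zp1_inversion q : (1 < q)%N ->
  exists s, [/\ s \in Aut <[Zp1 : 'Z_q]>%g, (#[s]%g %| 2)%N
              & s Zp1 = (Zp1 ^+ q.-1)%g].
Proof.
move=> q_gt1; pose s := perm (@invg_inj ('Z_q)); exists s.
have memB (c : 'Z_q) : (c \in <[Zp1 : 'Z_q]>)%g by rewrite -Zp_cycle inE.
split.
- rewrite inE; apply/andP; split.
    by apply/subsetP=> c _; apply: memB.
  by apply/morphicP=> c d _ _; rewrite !permE invMg; apply: (@addrC 'Z_q).
- rewrite order_dvdn; apply/eqP/permP=> c.
  by rewrite permM !permE invgK.
- rewrite permE; apply/eqP; rewrite eq_invg_mul -expgS prednK ?(ltnW q_gt1) //.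
  by rewrite -order_dvdn order_Zp1 (Zp_cast q_gt1).
Qed.

(** The relations alone only bound the order from above. For the converse, [G] maps onto a concrete
    model: the semidirect product of ['Z_(2 * r + 1)] by a cyclic group of order [2 ^ k] whose
    generator acts by inversion. *)
Lemma card_D_presentation_ge k r (gT : finGroupType) (G : {group gT}) x y :
    (0 < k)%N -> (0 < r)%N -> D_presentation k r G x y ->
  (2 ^ k * (2 * r + 1) <= #|G|)%N.
Proof.
move=> k_gt0 r_gt0 [isoG _ _ _ _].
have p_gt1 : (1 < 2 ^ k)%N by rewrite -{1}(expn0 2) ltn_exp2l.
have q_gt1 : (1 < 2 * r + 1)%N by lia.
have [s [As os sb]] := Zp1_inversion q_gt1.
rewrite -(Extremal.card (2 * r + 1).-1 p_gt1 q_gt1); apply: leq_homg.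
rewrite isoG.
have : exists s, [/\ s \in Aut <[Zp1 : 'Z_(2 * r + 1)]>%g, (#[s]%g %| 2 ^ k)%N
              & s Zp1 = (Zp1 ^+ (2 * r + 1).-1)%g].
  by exists s; split=> //; apply: dvdn_trans os (dvdn_exp k_gt0 (dvdnn 2)).
move/(Extremal.Grp p_gt1 q_gt1)/isoGrp_hom/existsP=> [[b a]] /=.
rewrite !xpair_eqE => /and4P[/eqP defH /eqP bq /eqP ap /eqP ba].
apply/existsP; exists (a, b); rewrite /= !xpair_eqE.
rewrite joingC defH eqxx ap bq !eqxx /=.
have bVE : (b ^+ (2 * r + 1).-1 = b^-1)%g.
  by apply/esym/eqP; rewrite eq_invg_mul -expgS prednK ?bq // addn1.
(* The model inverts [b] under conjugation by [a], the presentation under conjugation by [a^-1]; the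
   two conditions are equivalent. *)
have : (b ^ a^-1 = b^-1)%g.
  by apply: (conjg_inj a); rewrite -conjgM mulVg conjg1 conjVg ba bVE invgK.
by rewrite conjgE invgK mulgA => ->.
Qed.

(** * Normal form of the elements, construction of representations, conjugacy classes *)

Section NormalForm.

Variables (k r : nat) (gT : finGroupType) (G : {group gT}) (x y : gT).
Hypotheses (k_gt0 : (0 < k)%N) (r_gt0 : (0 < r)%N).
Hypothesis presG : D_presentation k r G x y.

Local Notation p := (2 ^ k)%N.
Local Notation q := (2 * r + 1)%N.

Lemma D_yx : (y * x = x * y^-1)%g.
Proof.
case: presG => _ _ _ _ xyx; apply: (mulgI y^-1%g); rewrite mulKg.
have xy : (x * y = y^-1 * x)%g by rewrite -xyx mulgKV.
by rewrite mulgA -xy mulgK.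
Qed.

Lemma D_conj_yx : (y ^ x = y^-1)%g.
Proof. by rewrite conjgE D_yx mulKg. Qed.

Lemma D_yVE : (y^-1 = y ^+ (2 * r))%g.
Proof.
case: presG => _ _ _ yq _; apply/eqP.
by rewrite eq_invg_mul -expgS -addn1 yq.
Qed.

(** The factor [(2 * r) ^ j] is [(-1)^j] modulo [2r+1], written so that exponents stay natural
    numbers. *)
Lemma D_commute_expyx a j :
  (y ^+ a * x ^+ j = x ^+ j * y ^+ (a * (2 * r) ^ j))%g.
Proof.
have base a' : (y ^+ a' * x = x * y ^+ (a' * (2 * r)))%g.
  elim: a' => [|a' IH]; first by rewrite mulg1 mul1g.
  by rewrite expgS -mulgA IH mulgA D_yx D_yVE -mulgA -expgD -mulSn.
elim: j a => [|j IH] a; first by rewrite muln1 mul1g mulg1.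
by rewrite expgS mulgA base -mulgA IH mulgA -mulnA -expnS.
Qed.

Lemma D_defG : (<[x]> * <[y]> = G)%g.
Proof.
case: presG => _ -> _ _ _; rewrite -norm_joinEl.
  by rewrite /cycle joing_idl joing_idr.
by rewrite norms_cycle D_conj_yx groupV cycle_id.
Qed.

(** The relations make the orders of [x] and [y] divide the coprime numbers [p] and [q], so [#|G|]
    is the product of these orders; the lower bound [p * q] forces equality in both. *)
Lemma D_order : [/\ #[x]%g = p, #[y]%g = q & #|G| = (p * q)%N].
Proof.
case: (presG) => _ _ xp yq _.
have px : (#[x]%g %| p)%N by rewrite order_dvdn xp.
have qy : (#[y]%g %| q)%N by rewrite order_dvdn yq.
have co_pq : coprime p q by rewrite coprimeXl // coprime2n; lia.
have TI : (<[x]> :&: <[y]> = 1)%g.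
  by apply: coprime_TIg; apply: coprime_dvdl px (coprime_dvdr qy co_pq).
have cardG : #|G| = (#[x]%g * #[y]%g)%N by rewrite -D_defG TI_cardMg.
have := card_D_presentation_ge k_gt0 r_gt0 presG; rewrite cardG => le_pq.
have p_gt0 : (0 < p)%N by rewrite expn_gt0.
have le_x := dvdn_leq p_gt0 px.
have q_gt0 : (0 < q)%N by rewrite addn1.
have le_y := dvdn_leq q_gt0 qy.
suff [ox oy] : #[x]%g = p /\ #[y]%g = q by rewrite ox oy.
split; nia.
Qed.

Lemma D_normalP g : g \in G ->
  exists i a, [/\ (i < p)%N, (a < q)%N & g = (x ^+ i * y ^+ a)%g].
Proof.
have [ox oy _] := D_order.
rewrite -D_defG => /mulsgP[_ _ /cyclePmin[i lt_i ->] /cyclePmin[a lt_a ->] ->].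
by exists i, a; rewrite -ox -oy.
Qed.

Lemma D_mem i a : (x ^+ i * y ^+ a)%g \in G.
Proof. by rewrite -D_defG mem_mulg ?mem_cycle. Qed.

Lemma D_mem_x : x \in G.
Proof. by have := D_mem 1 0; rewrite mulg1. Qed.

Lemma D_mem_y : y \in G.
Proof. by have := D_mem 0 1; rewrite mul1g. Qed.

Lemma D_normal_inj i a j b : (x ^+ i * y ^+ a = x ^+ j * y ^+ b)%g ->
  i = j %[mod p] /\ a = b %[mod q].
Proof.
have [ox oy cG] := D_order => eq_ij.
have TI : (<[x]> :&: <[y]> = 1)%g.
  by apply: coprime_TIg; rewrite -!orderE ox oy coprimeXl // coprime2n; lia.
have eq_ba : (x ^- j * x ^+ i = y ^+ b * y ^- a)%g.
  by apply: (mulgI (x ^+ j)%g); rewrite mulKVg mulgA -eq_ij mulgK.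
have : (x ^- j * x ^+ i)%g \in (<[x]> :&: <[y]>)%g.
  by rewrite inE {2}eq_ba !groupM ?groupV ?mem_cycle.
rewrite TI inE -eq_mulVg1 eq_sym => /eqP eq_x.
have eq_y : (y ^+ a = y ^+ b)%g by apply: (mulgI (x ^+ i)%g); rewrite eq_ij eq_x.
by split; apply/eqP; rewrite -?ox -?oy -eq_expg_mod_order ?eq_x ?eq_y.
Qed.

Lemma D_mulE i a j b : (x ^+ i * y ^+ a * (x ^+ j * y ^+ b)
  = x ^+ (i + j) * y ^+ (a * (2 * r) ^ j + b))%g.
Proof.
by rewrite mulgA -(mulgA (x ^+ i)%g) D_commute_expyx mulgA -expgD -mulgA -expgD.
Qed.

(** The condition [N * M * N = M] is the relation [x y x^-1 = y^-1] freed of inverses. The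
    conclusion is a sigma type, so that families of representations can be defined by projection. *)
Lemma D_representation n (M N : 'M[algC]_n.+1) :
    M ^+ p = 1 -> N ^+ q = 1 -> N * M * N = M ->
  {rG : mx_representation algC G n.+1
      | forall i a, rG (x ^+ i * y ^+ a)%g = M ^+ i * N ^+ a}.
Proof.
move=> Mp Nq NMN.
have NM : N * M = M * N ^+ (2 * r).
  have Nq' : N ^+ (2 * r).+1 = 1 by rewrite -[(2 * r).+1]addn1.
  by rewrite -[in RHS]NMN -[RHS]mulrA -exprS Nq' mulr1.
have NMexp a j : N ^+ a * M ^+ j = M ^+ j * N ^+ (a * (2 * r) ^ j).
  have base a' : N ^+ a' * M = M * N ^+ (a' * (2 * r)).
    elim: a' => [|a' IH]; first by rewrite mulr1 mul1r.
    by rewrite exprS -mulrA IH mulrA NM -mulrA -exprD -mulSn.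
  elim: j a => [|j IH] a; first by rewrite muln1 mul1r mulr1.
  by rewrite exprS mulrA base -mulrA IH mulrA -mulnA -expnS.
(* The default [0] is taken only outside [G], since every element of [G] has a normal form. *)
pose f g := if [pick ia : 'I_p * 'I_q | g == (x ^+ ia.1 * y ^+ ia.2)%g]
            is Some ia then M ^+ ia.1 * N ^+ ia.2 else 0.
have p_gt0 : (0 < p)%N by rewrite expn_gt0.
have q_gt0 : (0 < q)%N by rewrite addn1.
have fE i a : f (x ^+ i * y ^+ a)%g = M ^+ i * N ^+ a.
  case: (presG) => _ _ xp yq _.
  rewrite /f; case: pickP => [[i' a'] /= /eqP/D_normal_inj[eq_i eq_a]|].
    by rewrite -(expr_mod i Mp) -(expr_mod a Nq) eq_i eq_a !expr_mod.
  move/(_ (Ordinal (ltn_pmod i p_gt0), Ordinal (ltn_pmod a q_gt0))).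
  by rewrite /= !expg_mod // eqxx.
have frepr : mx_repr G f.
  split; first by have := fE 0%N 0%N; rewrite !mulr1 mulg1.
  move=> g h /D_normalP[i [a [_ _ ->]]] /D_normalP[j [b [_ _ ->]]].
  rewrite D_mulE !fE -[_ *m _]/((M ^+ i * N ^+ a) * (M ^+ j * N ^+ b)).
  by rewrite mulrA -(mulrA (M ^+ i)) NMexp mulrA -exprD -mulrA -exprD.
by exists (MxRepresentation frepr).
Qed.

Lemma D_central_x2 l g : g \in G -> ((x ^+ (2 * l)) ^ g = x ^+ (2 * l))%g.
Proof.
move=> /D_normalP[i [a [_ _ ->]]]; apply/conjg_fixP/commgP.
apply: commuteM; first exact/commuteX/commute_sym/commuteX.
apply: commuteX; apply: commute_sym; rewrite expgM; apply: commuteX.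
rewrite /commute expgS expg1 mulgA D_yx -!mulgA; congr (_ * _)%g.
have := D_conj_yx => /(congr1 invg); rewrite -conjVg invgK conjgE => h.
by apply: (mulgI x^-1%g); rewrite h mulKg.
Qed.

Lemma D_conj_y i a b : ((y ^+ b) ^ (x ^+ i * y ^+ a)
  = if odd i then y ^- b else y ^+ b)%g.
Proof.
have conj_i j : ((y ^+ b) ^ (x ^+ j) = if odd j then y ^- b else y ^+ b)%g.
  elim: j => [|j IH]; first by rewrite conjg1.
  rewrite expgSr conjgM IH /=; case: (odd j); rewrite ?conjVg conjXg D_conj_yx.
    by rewrite expVgn invgK.
  by rewrite expVgn.
have conj_y : ((y ^+ b) ^ (y ^+ a) = y ^+ b)%g.
  by apply/conjg_fixP/commgP/commuteX/commute_sym/commuteX.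
by rewrite conjgM conj_i; case: (odd i); rewrite ?conjVg conj_y.
Qed.

Lemma D_class_even l b :
  ((x ^+ (2 * l) * y ^+ b) ^: G = class_2 x y l b)%g.
Proof.
apply/setP=> g; apply/imsetP/set2P => [[h Gh ->]|].
  rewrite conjMg D_central_x2 //; have [i [a [_ _ ->]]] := D_normalP Gh.
  by rewrite D_conj_y; case: ifP; [right | left].
case=> ->; [exists 1%g | exists x]; rewrite ?group1 ?conjg1 ?D_mem_x //.
by rewrite conjMg D_central_x2 ?D_mem_x // conjXg D_conj_yx expVgn.
Qed.

Lemma D_class_odd l b : ((x ^+ (2 * l + 1) * y ^+ b) ^: G = class_odd x y r l)%g.
Proof.
case: (presG) => _ _ xp yq _.
have yqc c : (y ^+ (q * c + c) = y ^+ c)%g.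
  by rewrite expgD expgM yq expg1n mul1g.
have conj_x c : ((x ^+ (2 * l + 1)) ^ (y ^+ c) = x ^+ (2 * l + 1) * y ^+ (2 * c))%g.
  rewrite expgD expg1 conjMg D_central_x2 ?groupX ?D_mem_y // -mulgA.
  congr (_ * _)%g; apply: (mulgI (y ^+ c)%g).
  rewrite conjgE mulKVg mulgA; have := D_commute_expyx c 1.
  rewrite expg1 expn1 => ->; rewrite -!mulgA -!expgD; congr (_ * _)%g.
  rewrite (_ : (c * (2 * r) + 2 * c = q * c + c)%N); last by lia.
  by rewrite yqc.
have mem_class c : (x ^+ (2 * l + 1) * y ^+ c)%g \in (x ^+ (2 * l + 1) ^: G)%g.
  (* Conjugation by a power of [y] doubles its exponent, and [r + 1] is the inverse of [2] modulo
     [2r+1]. *)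
  apply/imsetP; exists (y ^+ (c * (r + 1)))%g; first by rewrite groupX ?D_mem_y.
  rewrite conj_x (_ : (2 * (c * (r + 1)) = q * c + c)%N); last by lia.
  by rewrite yqc.
rewrite (class_eqP (mem_class b)).
apply/setP=> g; apply/idP/imsetP => [/imsetP[h Gh ->]|[a _ ->]]; last exact: mem_class.
have [i [a [_ _ ->]]] := D_normalP Gh.
rewrite conjgM (_ : (x ^+ (2 * l + 1)) ^ (x ^+ i) = x ^+ (2 * l + 1))%g; last first.
  by apply/conjg_fixP/commgP/commuteX/commute_sym/commuteX.
have q_gt0 : (0 < q)%N by rewrite addn1.
exists (Ordinal (ltn_pmod (2 * a) q_gt0)) => //=.
by rewrite conj_x expg_mod.
Qed.

(** Only this inclusion is proved by computation; that the list has no repetitions and no further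
    members follows later by counting. *)
Lemma D_classes_sub : {subset classes G <=
  [seq class_1 x l | l <- iota 0 (2 ^ (k - 1))]
  ++ [seq class_2 x y l c | l <- iota 0 (2 ^ (k - 1)), c <- iota 1 r]
  ++ [seq class_odd x y r l | l <- iota 0 (2 ^ (k - 1))]}.
Proof.
case: (presG) => _ _ xp yq _.
move=> _ /imsetP[_ /D_normalP[i [a [lt_i lt_a ->]]] ->].
have lt_l : (i./2 \in iota 0 (2 ^ (k - 1)))%N.
  have pE : (2 ^ k = 2 * 2 ^ (k - 1))%N by rewrite -expnS subn1 prednK.
  by rewrite mem_iota; lia.
rewrite !mem_cat; case: (boolP (odd i)) => odd_i.
  have -> : i = (2 * i./2 + 1)%N by lia.
  rewrite D_class_odd; apply/orP; right; apply/orP; right.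
  exact: (map_f (class_odd x y r)).
have -> : i = (2 * i./2)%N by lia.
rewrite D_class_even; case: (posnP a) => [->|a_gt0].
  apply/orP; left; rewrite /class_2 invg1 setUid mulg1.
  by apply: (map_f (class_1 x)).
apply/orP; right; apply/orP; left; apply/allpairsP.
case: (leqP a r) => [le_ar|lt_ra].
  by by exists (i./2, a); split=> //=; rewrite mem_iota; lia.
(* For [a > r] the other element of the class has exponent [q - a], which lies between [1] and
   [r]. *)
exists (i./2, (q - a)%N); split=> //=; first by rewrite mem_iota; lia.
have yE : (y ^+ (q - a) = y ^- a)%g.
  by apply: (mulIg (y ^+ a)%g); rewrite -expgD subnK ?yq ?mulVg // ltnW.
by rewrite /class_2 yE invgK setUC.
Qed.

End NormalForm.

(** * Two-by-two matrices, irreducibility in degree 2, powers of the representing matrices *)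

Lemma mx2_mul (a b c d a' b' c' d' : algC) :
  mx2 a b c d * mx2 a' b' c' d'
  = mx2 (a * a' + b * c') (a * b' + b * d') (c * a' + d * c') (c * b' + d * d').
Proof.
apply/matrixP=> i j; rewrite !mxE big_ord_recl big_ord1 !mxE /=.
by case: i => [[|[|i]] ?]; case: j => [[|[|j]] ?].
Qed.

Lemma mx2_scale (e a b c d : algC) :
  e *: mx2 a b c d = mx2 (e * a) (e * b) (e * c) (e * d).
Proof. by apply/matrixP=> i j; rewrite !mxE; do 2!case: ifP. Qed.

Lemma mx2_1 (a : algC) : mx2 a 0 0 a = a%:M.
Proof.
apply/matrixP=> i j; rewrite !mxE.
by case: i => [[|[|i]] ?]; case: j => [[|[|j]] ?].
Qed.

Lemma mx2_diagX (a d : algC) n : mx2 a 0 0 d ^+ n = mx2 (a ^+ n) 0 0 (d ^+ n).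
Proof.
elim: n => [|n IH]; first by rewrite !expr0 mx2_1.
by rewrite !exprS IH mx2_mul !(mul0r, mulr0, addr0, add0r).
Qed.

Lemma mx2_tr (a b c d : algC) : \tr (mx2 a b c d) = a + d.
Proof. by rewrite /mxtrace big_ord_recl big_ord1 !mxE. Qed.

(** If all constituents were linear, the derived subgroup would lie in the kernel. So some
    constituent has degree at least 2 and exhausts [chi], the remainder [psi] having degree 0. *)
Lemma char2_irr (gT : finGroupType) (G : {group gT}) (chi : 'CF(G)) :
    chi \is a character -> chi 1%g = 2 -> ~~ (G^`(1) \subset cfker chi)%g ->
  chi \in irr G.
Proof.
move=> Nchi chi1 nlin.
have [i Ci nlin_i] : exists2 i, i \in irr_constt chi & ~~ ('chi_i \is a linear_char).
  apply/exists_inP; apply: contraNT nlin; rewrite negb_exists_in => /forall_inP lin.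
  rewrite cfkerE // subsetI der_sub; apply/bigcapsP=> i Ci.
  by rewrite -lin_irr_der1 -[_ \is a _]negbK lin.
have [psi Npsi def_chi] := constt_charP i Nchi Ci.
have psi0 : psi = 0.
  apply/eqP; rewrite -char1_eq0 //.
  have := congr1 (fun phi : 'CF(G) => phi 1%g) def_chi; rewrite /= cfunE chi1.
  move: nlin_i (irr1_gt0 i); rewrite qualifE /= irr_char /=.
  have /natrP[m ->] := Cnat_irr1 i; have /natrP[n ->] := Cnat_char1 Npsi.
  rewrite -natrD => m_neq1 m_gt0 /eqP.
  rewrite eqr_nat pnatr_eq0 pnatr_eq1 ltr0n in m_neq1 m_gt0 *.
  by lia.
by rewrite def_chi psi0 addr0 mem_irr.
Qed.

Lemma rho_xX2 k t s l :
  rho_x k t s ^+ (2 * l) = ((-1) ^+ (t * l) * zeta (2 ^ k) ^+ (2 * l * s))%:M.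
Proof.
have rho2 : rho_x k t s ^+ 2 = ((-1) ^+ t * zeta (2 ^ k) ^+ (s * 2))%:M.
  rewrite /rho_x expr2 mx2_scale mx2_mul -mx2_1 exprM.
  by congr mx2; ring.
rewrite exprM rho2 -mx2_1 mx2_diagX mx2_1 exprMn -!exprM.
by rewrite (_ : (s * 2 * l = 2 * l * s)%N) //; lia.
Qed.

Lemma zeta_neq0 n : (0 < n)%N -> zeta n != 0.
Proof. by move=> n_gt0; rewrite expf_neq0 // rootC_eq0 // oppr_eq0 oner_eq0. Qed.

Lemma rho_yX r t a :
  rho_y r t ^+ a = mx2 (zeta (2 * r + 1) ^+ (t * a)) 0 0 (zeta (2 * r + 1) ^- (t * a)).
Proof. by rewrite /rho_y mx2_diagX exprVn -!exprM. Qed.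

Lemma rho_yxy r k t s : rho_y r t * rho_x k t s * rho_y r t = rho_x k t s.
Proof.
have q_gt0 : (0 < 2 * r + 1)%N by rewrite addn1.
rewrite /rho_x /rho_y mx2_scale !mx2_mul.
have wN : zeta (2 * r + 1) ^+ t != 0 by rewrite expf_neq0 ?zeta_neq0.
by congr mx2; field.
Qed.

Lemma alpha_xX k j i : alpha_x k j ^+ i = (zeta (2 ^ k) ^+ (i * j))%:M.
Proof. by rewrite /alpha_x -rmorphXn /= -exprM mulnC. Qed.

(** * Recovering the parameters [t] and [s] from character values *)

Lemma zeta_half k : (0 < k)%N -> zeta (2 ^ k) ^+ (2 ^ (k - 1)) = -1.
Proof.
move=> k_gt0; have pE : (2 ^ (k - 1) * 2 = 2 ^ k)%N by rewrite -expnSr subn1 prednK.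
have zP : (2 ^ k).-primitive_root (zeta (2 ^ k)) by rewrite zeta_prim ?expn_gt0.
have : (zeta (2 ^ k) ^+ (2 ^ (k - 1))) ^+ 2 == 1.
  by rewrite -exprM pE (prim_expr_order zP).
rewrite sqrf_eq1 => /orP[|/eqP //].
by rewrite -(prim_order_dvd zP) dvdn_Pexp2l //; lia.
Qed.

(** With [-1] written as a power of [zeta (2 ^ k)], each side has exponent [2^(k-1) e + 2s], where
    [e] is the parity of [t]. As [2s < 2^(k-1)], this exponent is below [2^k] and determines [e] and
    [s]. *)
Lemma sign_zeta_inj k t s t' s' : (1 < k)%N ->
    (s < 2 ^ (k - 2))%N -> (s' < 2 ^ (k - 2))%N ->
    (-1) ^+ t * zeta (2 ^ k) ^+ (2 * s) = (-1) ^+ t' * zeta (2 ^ k) ^+ (2 * s') ->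
  odd t = odd t' /\ s = s'.
Proof.
move=> k_gt1 lt_s lt_s'.
rewrite -(signr_odd _ t) -(signr_odd _ t') -(zeta_half (ltnW k_gt1)).
have zP : (2 ^ k).-primitive_root (zeta (2 ^ k)) by rewrite zeta_prim ?expn_gt0.
move: (zeta _) zP => z zP.
rewrite -!exprM -!exprD => /eqP; rewrite (eq_prim_root_expr zP).
have -> : (2 ^ k = 4 * 2 ^ (k - 2))%N by rewrite -(expnD 2 2) subnKC.
have -> : (2 ^ (k - 1) = 2 * 2 ^ (k - 2))%N by rewrite -expnS; congr (2 ^ _)%N; lia.
move: (2 ^ (k - 2))%N lt_s lt_s' => P lt_s lt_s'.
by rewrite !modn_small; case: (odd t); case: (odd t') => /=; lia.
Qed.

(** A sum [a + 1/a] determines [a] up to inversion, because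
    [(a - b)(ab - 1) = ab (a + 1/a - b - 1/b)]. *)
Lemma unity_addV_inj n (w : algC) t t' : n.-primitive_root w ->
    (0 < t < n)%N -> (0 < t' < n)%N ->
    w ^+ t + w ^- t = w ^+ t' + w ^- t' ->
  t = t' \/ (t + t')%N = n.
Proof.
move=> wP lt_t lt_t' eq_w.
have w_neq0 : w != 0.
  apply/eqP=> w0; have := prim_expr_order wP.
  by move/eqP; rewrite w0 expr0n gtn_eqF ?(prim_order_gt0 wP) // eq_sym oner_eq0.
have wt m : w ^+ m != 0 by rewrite expf_neq0.
have : (w ^+ t - w ^+ t') * (w ^+ (t + t') - 1) == 0.
  rewrite exprD; apply/eqP.
  have -> : (w ^+ t - w ^+ t') * (w ^+ t * w ^+ t' - 1) =
    w ^+ t * w ^+ t' * (w ^+ t + w ^- t - (w ^+ t' + w ^- t')).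
    by field; rewrite !wt.
  by rewrite eq_w subrr mulr0.
rewrite mulf_eq0 !subr_eq0 => /orP[].
  rewrite (eq_prim_root_expr wP) !modn_small; [move/eqP; by left | lia | lia].
by rewrite -(prim_order_dvd wP) => /dvdnP[[|[|m]] tt'E]; right; nia.
Qed.

(** * The character table, completed by counting *)

Theorem mainTheorem6 (k r : nat) (gT : finGroupType) (G : {group gT})
    (x y : gT) (hk : (2 < k)%N) (hr : (1 <= r)%N)
    (hG : D_presentation k r G x y) :
  exists (alpha : nat -> mx_representation algC G 1)
         (rho : nat -> nat -> mx_representation algC G 2),
  [/\ (* the representations alpha_j and rho_(t,s) *)
      (forall j, alpha j x = alpha_x k j /\ alpha j y = 1%:M)
      /\ (forall t s, rho t s x = rho_x k t s /\ rho t s y = rho_y r t),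
      (* the irreducible characters, without repetition *)
      Nirr G = (2 ^ (k - 1) * (r + 2))%N
      /\ perm_eq (irr G)
           ([seq cfRepr (alpha j) | j <- iota 0 (2 ^ k)]
            ++ [seq cfRepr (rho t s) | t <- iota 1 (2 * r),
                                       s <- iota 0 (2 ^ (k - 2))]),
      (* the conjugacy classes, without repetition *)
      perm_eq (enum (classes G))
        ([seq class_1 x l | l <- iota 0 (2 ^ (k - 1))]
         ++ [seq class_2 x y l q | l <- iota 0 (2 ^ (k - 1)), q <- iota 1 r]
         ++ [seq class_odd x y r l | l <- iota 0 (2 ^ (k - 1))]),
      (* the values of the characters of the alpha_j *)
      forall j l, (j < 2 ^ k)%N -> (l < 2 ^ (k - 1))%N ->
        [/\ forall g, g \in class_1 x l ->
              cfRepr (alpha j) g = zeta (2 ^ k) ^+ (2 * l * j),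
            forall q g, (1 <= q <= r)%N -> g \in class_2 x y l q ->
              cfRepr (alpha j) g = zeta (2 ^ k) ^+ (2 * l * j)
          & forall g, g \in class_odd x y r l ->
              cfRepr (alpha j) g = zeta (2 ^ k) ^+ ((2 * l + 1) * j)]
      (* the values of the characters of the rho_(t,s) *)
    & forall t s l, (1 <= t <= 2 * r)%N -> (s < 2 ^ (k - 2))%N ->
        (l < 2 ^ (k - 1))%N ->
        [/\ forall g, g \in class_1 x l ->
              cfRepr (rho t s) g
              = (-1) ^+ (t * l) * 2 * zeta (2 ^ k) ^+ (2 * l * s),
            forall q g, (1 <= q <= r)%N -> g \in class_2 x y l q ->
              cfRepr (rho t s) g
              = (-1) ^+ (t * l) * zeta (2 ^ k) ^+ (2 * l * s)
                * (zeta (2 * r + 1) ^+ (t * q) + zeta (2 * r + 1) ^- (t * q))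
          & forall g, g \in class_odd x y r l -> cfRepr (rho t s) g = 0]].
Proof.
have k_gt0 : (0 < k)%N by lia.
have r_gt0 : (0 < r)%N by [].
have p_gt0 : (0 < 2 ^ k)%N by rewrite expn_gt0.
have q_gt0 : (0 < 2 * r + 1)%N by rewrite addn1.
have zP := zeta_prim p_gt0; have wP := zeta_prim q_gt0.
have pE : (2 ^ k = 2 * 2 ^ (k - 1))%N by rewrite -expnS subn1 prednK.
have pE4 : (2 ^ (k - 1) = 2 * 2 ^ (k - 2))%N by rewrite -expnS; congr (2 ^ _)%N; lia.
have [alpha alphaE] : exists alpha : nat -> mx_representation algC G 1,
    forall j i a, alpha j (x ^+ i * y ^+ a)%g = (zeta (2 ^ k) ^+ (i * j))%:M.
  have ax j : alpha_x k j ^+ (2 ^ k) = 1.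
    by rewrite alpha_xX exprM (prim_expr_order zP) expr1n.
  have ay : (1 : 'M[algC]_1) ^+ (2 * r + 1) = 1 by rewrite expr1n.
  have axy j : 1 * alpha_x k j * 1 = alpha_x k j by rewrite mul1r mulr1.
  pose rep j := D_representation k_gt0 r_gt0 hG (ax j) ay (axy j).
  exists (fun j => sval (rep j)) => j i a.
  by case: (rep j) => rG /= ->; rewrite alpha_xX expr1n mulr1.
have [rho rhoE] : exists rho : nat -> nat -> mx_representation algC G 2,
    forall t s i a, rho t s (x ^+ i * y ^+ a)%g = rho_x k t s ^+ i * rho_y r t ^+ a.
  have rx t s : rho_x k t s ^+ (2 ^ k) = 1.
    rewrite pE rho_xX2 -pE [zeta _ ^+ _]exprM (prim_expr_order zP) expr1n mulr1.
    (* The sign [(-1)^(t 2^(k-1))] is [1] because [2^(k-1)] is even. *)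
    by rewrite mulnC pE4 -mulnA exprM sqrrN !expr1n.
  have ry t : rho_y r t ^+ (2 * r + 1) = 1.
    by rewrite rho_yX [(t * _)%N]mulnC exprM (prim_expr_order wP) expr1n invr1 mx2_1.
  pose rep t s := D_representation k_gt0 r_gt0 hG (rx t s) (ry t) (rho_yxy r k t s).
  exists (fun t s => sval (rep t s)) => t s i a.
  by case: (rep t s) => rG /= ->.
have memG i a := D_mem hG i a.
have chiA j i a : cfRepr (alpha j) (x ^+ i * y ^+ a)%g = zeta (2 ^ k) ^+ (i * j).
  by rewrite cfunE memG mulr1n alphaE mxtrace_scalar mulr1n.
have chiR t s l a : cfRepr (rho t s) (x ^+ (2 * l) * y ^+ a)%g
   = (-1) ^+ (t * l) * zeta (2 ^ k) ^+ (2 * l * s)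
     * (zeta (2 * r + 1) ^+ (t * a) + zeta (2 * r + 1) ^- (t * a)).
  rewrite cfunE memG mulr1n rhoE rho_xX2 rho_yX -mx2_1 mx2_mul mx2_tr.
  by rewrite !mul0r addr0 add0r mulrDr.
have chiR_odd t s l a : cfRepr (rho t s) (x ^+ (2 * l + 1) * y ^+ a)%g = 0.
  rewrite cfunE memG mulr1n rhoE exprD expr1 rho_xX2 rho_yX -mx2_1.
  rewrite /rho_x mx2_scale !mx2_mul mx2_tr.
  by rewrite !(mul0r, mulr0, addr0, add0r).
have class2_chi (phi : 'CF(G)) l c g : g \in class_2 x y l c ->
    phi g = phi (x ^+ (2 * l) * y ^+ c)%g.
  rewrite -(D_class_even k_gt0 r_gt0 hG) => /imsetP[h Gh ->]; exact: cfunJ.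
exists alpha, rho.
pose LA := [seq cfRepr (alpha j) | j <- iota 0 (2 ^ k)].
pose LR := [seq cfRepr (rho t s) | t <- iota 1 (2 * r), s <- iota 0 (2 ^ (k - 2))].
have uniqL : uniq (LA ++ LR).
  rewrite cat_uniq; apply/and3P; split.
  - rewrite map_inj_in_uniq ?iota_uniq // => j j'.
    rewrite !mem_iota !add0n => /andP[_ lt_j] /andP[_ lt_j'] eq_chi.
    have := congr1 (fun phi : 'CF(G) => phi (x ^+ 1 * y ^+ 0)%g) eq_chi.
    rewrite /= !chiA !mul1n => /eqP; rewrite (eq_prim_root_expr zP).
    by rewrite !modn_small // => /eqP.
  - apply/hasPn=> _ /allpairsP[[t s] [_ _ ->]] /=.
    apply/mapP=> [[j _]] /(congr1 (fun phi : 'CF(G) => phi 1%g)).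
    by rewrite /= !cfRepr1 => /eqP; rewrite eqr_nat.
  - apply: allpairs_uniq; rewrite ?iota_uniq //.
    move=> _ _ /allpairsP[[t s] /= [t_in s_in ->]] /allpairsP[[t' s'] /= [t'_in s'_in ->]] eq_chi.
    rewrite !mem_iota in t_in s_in t'_in s'_in.
    (* The value at [x^2] yields [s] and the parity of [t]; the value at [y] then yields [t] up to
       [t -> 2r+1 - t], and this exchange changes the parity. *)
    have := congr1 (fun phi : 'CF(G) => phi (x ^+ (2 * 1) * y ^+ 0)%g) eq_chi.
    rewrite /= !chiR !muln0 !muln1 expr0 invr1 => /mulIf eq_x.
    have [] := @sign_zeta_inj k t s t' s'; try lia.
      by apply: eq_x; rewrite -(natrD _ 1 1) pnatr_eq0.
    move=> odd_t ->; congr (_, _).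
    have := congr1 (fun phi : 'CF(G) => phi (x ^+ (2 * 0) * y ^+ 1)%g) eq_chi.
    rewrite /= !chiR !muln0 !muln1 mul0n !expr0 !mul1r => /(unity_addV_inj wP).
    by case; lia.
have subL : {subset LA ++ LR <= irr G}.
  move=> chi; rewrite mem_cat => /orP[/mapP[j _ ->]|/allpairsP[[t s] /= [t_in _ ->]]].
    by apply: lin_char_irr; rewrite qualifE /= cfRepr_char cfRepr1 eqxx.
  apply: char2_irr; rewrite ?cfRepr_char ?cfRepr1 //.
  (* The commutator of [y] and [x] is [y^-2 = y^(4r)]. Were it in the kernel, [2r+1] would divide
     [4rt], hence [t], as [4r] is coprime to [2r+1]; but [1 <= t <= 2r]. *)
  rewrite cfker_repr; apply/negP=> /subsetP/(_ [~ y, x]%g).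
  rewrite mem_commg ?(D_mem_x hG) ?(D_mem_y hG) // => /(_ isT)/rkerP[_].
  rewrite commgEl (D_conj_yx hG) (D_yVE hG) -expgD.
  have := rhoE t s 0%N (2 * r + 2 * r)%N; rewrite mul1g mul1r => -> /eqP.
  rewrite rho_yX => /eqP/matrixP/(_ 0 0); rewrite !mxE /= => /eqP.
  rewrite -(prim_order_dvd wP) Gauss_dvdl; last first.
    rewrite (_ : (2 * r + 2 * r = 2 * (2 * r))%N); last by lia.
    by rewrite coprimeMr coprimen2 coprime_sym {2}addn1 coprimenS andbT; lia.
  rewrite mem_iota in t_in => /dvdn_leq; lia.
have sizeL : size (LA ++ LR) = (2 ^ (k - 1) * (r + 2))%N.
  by rewrite size_cat size_map size_allpairs !size_iota; nia.
pose LC := [seq class_1 x l | l <- iota 0 (2 ^ (k - 1))]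
  ++ [seq class_2 x y l c | l <- iota 0 (2 ^ (k - 1)), c <- iota 1 r]
  ++ [seq class_odd x y r l | l <- iota 0 (2 ^ (k - 1))].
have sizeLC : size LC = (2 ^ (k - 1) * (r + 2))%N.
  by rewrite !size_cat !size_map size_allpairs !size_iota; nia.
have subC : {subset enum (classes G) <= LC}.
  by move=> C; rewrite mem_enum; apply: (D_classes_sub k_gt0 r_gt0 hG).
have size_irr : size (irr G) = #|classes G| by rewrite size_tuple NirrE.
have size_cl : size (enum (classes G)) = #|classes G| by rewrite -cardE.
(* With [N = 2^(k-1) (r+2)]: [N = size (LA ++ LR) <= size (irr G) = #|classes G| <= size LC = N], so
   equality holds throughout. *)
have leL := uniq_leq_size uniqL subL.
have leC := uniq_leq_size (enum_uniq _) subC.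
have irrE : size (irr G) = (2 ^ (k - 1) * (r + 2))%N.
  by apply/eqP; rewrite eqn_leq -{2}sizeL leL size_irr -size_cl -sizeLC leC.
split.
- split=> [j|t s].
    have := alphaE j 1%N 0%N; have := alphaE j 0%N 1%N.
    by rewrite !expg1 mul1g mulg1 mul0n mul1n expr0.
  have := rhoE t s 1%N 0%N; have := rhoE t s 0%N 1%N.
  by rewrite !expg1 mul1g mulg1 mul1r !expr1 mulr1.
- split; first by rewrite -irrE size_tuple.
  rewrite perm_sym; apply: uniq_perm => //; first exact: free_uniq (irr_free G).
  have [] := uniq_min_size uniqL subL _; last by [].
  by rewrite irrE sizeL.
(* A list no longer than a duplicate-free list that it contains is itself duplicate-free and has the
   same members. *)
- have leCC : (size LC <= size (enum (classes G)))%N.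
    by rewrite sizeLC size_cl -size_irr irrE.
  apply: uniq_perm; rewrite ?enum_uniq //.
    exact: leq_size_uniq (enum_uniq _) subC leCC.
  by have [] := uniq_min_size (enum_uniq _) subC leCC.
- move=> j l _ _; split=> [g|q g _|g].
  + by move=> /set1P->; have := chiA j (2 * l)%N 0%N; rewrite mulg1.
  + by move/class2_chi->; rewrite chiA.
  + by move=> /imsetP[a _ ->]; rewrite chiA.
- move=> t s l _ _ _; split=> [g|q g _|g].
  + move=> /set1P->; have := chiR t s l 0%N.
    by rewrite mulg1 muln0 expr0 invr1 mulrAC => ->; rewrite -(natrD _ 1 1).
  + by move/class2_chi->; rewrite chiR.
  + by move=> /imsetP[a _ ->]; rewrite chiR_odd.
Qed.
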